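(* Let $n \geq 4$ be an integer and let $CL_n$ be the graph of order $n$ obtained from the complete graph on $n-1$ vertices by attaching a leaf to one vertex, with degree polynomial $D(CL_n;x)$. If $n$ is odd, then $D(CL_n;x)$ has a real root in the interval $(-(n-2)-\epsilon_o(n),\, -(n-2))$, where $$\epsilon_o(n) = \frac{1}{(n-2)^{n-3}}.$$ If $n$ is even, then $D(CL_n;x)$ has a real root in the interval $(-(n-2),\, -(n-2)+\epsilon_e(n)]$, where $$\epsilon_e(n) = \frac{1}{(n-3)^{n-3}}.$$
   Context: The degree polynomial of a finite graph $G$ with vertex set $V$ is $D(G;x)=\sum_{v\in V} x^{\deg(v)}$. The order of a graph is its number of vertices. The graph $CL_n$ consists of a complete graph on $n-1$ vertices together with one additional vertex joined by a single edge to exactly one vertex of the complete graph; thus $D(CL_n;x)=x^{n-1}+(n-2)x^{n-2}+x$. *)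

(* Defs.v *)
From mathcomp Require Import all_boot all_order all_algebra.
From mathcomp Require Import reals.

Set Implicit Arguments.
Unset Strict Implicit.
Unset Printing Implicit Defensive.

Import GRing.Theory.
Local Open Scope ring_scope.

Record sgraph := SGraph {
  vertex :> finType;
  adj : rel vertex;
  adj_sym : symmetric adj;
  adj_irr : irreflexive adj }.

Definition degree (G : sgraph) (v : G) : nat := #|[set w : G | adj v w]|.

Definition degree_poly (R : nzRingType) (G : sgraph) : {poly R} :=
  \sum_(v : G) 'X^(degree v).

Section CL.
Variable n : nat.

(* The vertices 0, ..., n - 2 form the clique; n - 1 is the leaf, attached
   to the vertex 0. *)
Definition CL_adj (i j : 'I_n) : bool :=
  (i != j) && [|| (i < n.-1) && (j < n.-1),
                  (i == 0 :> nat) && (j == n.-1 :> nat) |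
                  (i == n.-1 :> nat) && (j == 0 :> nat)]%N.

Lemma CL_adj_sym : symmetric CL_adj.
Proof.
move=> i j; rewrite /CL_adj eq_sym.
congr (_ && _); rewrite [in LHS]andbC; congr (_ || _).
by rewrite orbC; congr (_ || _); rewrite andbC.
Qed.

Lemma CL_adj_irr : irreflexive CL_adj.
Proof. by move=> i; rewrite /CL_adj eqxx. Qed.

Definition CL : sgraph := SGraph CL_adj_sym CL_adj_irr.

End CL.

Definition eps_o (R : realType) (n : nat) : R :=
  1 / (n%:R - 2%:R) ^+ (n - 3).

Definition eps_e (R : realType) (n : nat) : R :=
  1 / (n%:R - 3%:R) ^+ (n - 3).

(* Main.v *)
Require Import Defs.
From mathcomp Require Import all_boot all_order all_algebra.
From mathcomp Require Import reals.
From mathcomp Require Import zify ring lra.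

Set Implicit Arguments.
Unset Strict Implicit.
Unset Printing Implicit Defensive.

Import Order.TTheory GRing.Theory Num.Theory.
Local Open Scope ring_scope.

(** Write n = k + 3.  The attaching vertex of CL_n has degree k + 2, the leaf
    degree 1 and the k + 1 remaining vertices degree k + 1, so that
      D(CL_n; x) = x q(x),  where  q(x) = x^k (x + (k + 1)) + 1
    ([degree_poly_CL]).  So a root of the cofactor q is what is sought, and
    substituting x = - y gives q(- y) = 1 + (-1)^k y^k (k + 1 - y)
    ([horner_CL_cofactor]).  At y = k + 1 = n - 2 the value is 1, so by the
    intermediate value theorem it is enough that q be nonpositive at the
    other end of each interval.

    For n odd, k is even, and y = (k + 1) + e with e = 1 / (k + 1)^k gives
    q(- y) = 1 - (y / (k + 1))^k, which is negative because y > k + 1 and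
    k > 0.  For n even, k is odd, and y = (k + 1) - e with e = 1 / k^k gives
    q(- y) = 1 - (y / k)^k, which is nonpositive because e <= 1 makes y >= k;
    it vanishes when k = 1, whence the closed endpoint. *)

Lemma degree_CL_hub (m : nat) : @degree (CL m.+2) (ord0 : 'I_m.+2) = m.+1.
Proof.
rewrite /degree (_ : [set w | _] = [set~ (ord0 : 'I_m.+2)]).
  by rewrite cardsC1 card_ord.
apply/setP=> j; rewrite !inE /= /CL_adj /= -!(inj_eq val_inj) /=.
by have := ltn_ord j; lia.
Qed.

Lemma degree_CL_leaf (m : nat) : @degree (CL m.+2) (ord_max : 'I_m.+2) = 1%N.
Proof.
rewrite /degree (_ : [set w | _] = [set (ord0 : 'I_m.+2)]) ?cards1 //.
apply/setP=> j; rewrite !inE /= /CL_adj /= -!(inj_eq val_inj) /=.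
by have := ltn_ord j; lia.
Qed.

Lemma degree_CL_clique (m : nat) (i : 'I_m.+2) :
  i != ord0 -> i != ord_max -> @degree (CL m.+2) i = m.
Proof.
move=> i_neq0 i_neqmax.
rewrite /degree (_ : [set w | _] = ~: [set i; (ord_max : 'I_m.+2)]).
  by rewrite cardsCs setCK cards2 i_neqmax card_ord subSS subn1.
apply/setP=> j; move: i_neq0 i_neqmax.
rewrite !inE /= /CL_adj /= -!(inj_eq val_inj) /=.
by have := ltn_ord j; have := ltn_ord i; lia.
Qed.

(** The factor that carries the nonzero roots of D(CL_(k+3); x). *)
Definition CL_cofactor (R : nzRingType) (k : nat) : {poly R} :=
  'X^k * ('X + k.+1%:R%:P) + 1.

Lemma degree_poly_CL (R : comNzRingType) (k : nat) :
  degree_poly R (CL k.+3) = 'X * CL_cofactor R k.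
Proof.
rewrite /degree_poly /= big_ord_recl big_ord_recr /=.
rewrite (_ : lift _ _ = ord_max); last exact/val_inj.
rewrite degree_CL_hub degree_CL_leaf.
rewrite (eq_bigr (fun=> 'X^(k.+1) : {poly R})); last first.
  move=> i _; rewrite degree_CL_clique // -(inj_eq val_inj) /= /bump /=.
  by have := ltn_ord i; lia.
rewrite sumr_const card_ord /CL_cofactor polyC_natr -[_ *+ k.+1]mulr_natr.
rewrite !exprS expr0.
ring.
Qed.

Lemma horner_CL_cofactor (R : comNzRingType) (k : nat) (y : R) :
  (CL_cofactor R k).[- y] = 1 + (-1) ^+ k * (y ^+ k * (k.+1%:R - y)).
Proof.
rewrite /CL_cofactor !(hornerD, hornerM, hornerXn, hornerX, hornerC).
by rewrite [(- y) ^+ k]exprNn; ring.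
Qed.

Lemma CL_cofactor_at_clique_size (R : comNzRingType) (k : nat) :
  (CL_cofactor R k).[- k.+1%:R] = 1.
Proof. by rewrite horner_CL_cofactor subrr !mulr0 addr0. Qed.

(** The value is 1 - (y / (k + 1))^k for some y > k + 1; at k = 0 it is 0, as
    the excess of y over k + 1 needs a positive exponent to survive. *)
Lemma CL_cofactor_even_lt0 (R : realFieldType) (k : nat) :
  (0 < k)%N -> ~~ odd k ->
  (CL_cofactor R k).[- (k.+1%:R + 1 / k.+1%:R ^+ k)] < 0.
Proof.
move=> k_gt0 even_k; rewrite horner_CL_cofactor -signr_odd (negPf even_k).
have c_gt0 : 0 < k.+1%:R ^+ k :> R by rewrite exprn_gt0 ?ltr0n.
set e := 1 / _; have e_gt0 : 0 < e by rewrite divr_gt0.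
rewrite expr0 mul1r opprD addNKr mulrN subr_lt0.
rewrite {2}/e mulrA mulr1 ltr_pdivlMr // mul1r.
by rewrite ltrXn2r ?ler0n // -?lt0n // ltrDl.
Qed.

(** The value is 1 - (y / k)^k, where y = (k + 1) - 1 / k^k >= k since
    k^k >= 1. *)
Lemma CL_cofactor_odd_le0 (R : realFieldType) (k : nat) :
  odd k -> (CL_cofactor R k).[- (k.+1%:R - 1 / k%:R ^+ k)] <= 0.
Proof.
move=> odd_k; have k_gt0 : (0 < k)%N by case: k odd_k.
rewrite horner_CL_cofactor -signr_odd odd_k.
have c_ge1 : 1 <= k%:R ^+ k :> R by rewrite exprn_ege1 ?ler1n.
have c_gt0 : 0 < k%:R ^+ k :> R by rewrite (lt_le_trans ltr01).
set e := 1 / _; have e_le1 : e <= 1 by rewrite ler_pdivrMr ?mul1r.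
rewrite expr1 mulN1r subKr subr_le0.
rewrite {2}/e mulrA mulr1 ler_pdivlMr // mul1r.
rewrite lerXn2r ?nnegrE ?ler0n //.
  by rewrite subr_ge0 (le_trans e_le1) ?ler1n.
by rewrite -natr1; lra.
Qed.

Theorem proposition2p1 (R : realType) (n : nat) (hn : (4 <= n)%N) :
  (odd n ->
     exists x : R,
       - (n%:R - 2%:R) - eps_o R n < x < - (n%:R - 2%:R) /\
       root (degree_poly R (CL n)) x) /\
  (~~ odd n ->
     exists x : R,
       - (n%:R - 2%:R) < x <= - (n%:R - 2%:R) + eps_e R n /\
       root (degree_poly R (CL n)) x).
Proof.
case: n hn => [|[|[|k]]] // k_gt0; rewrite !ltnS in k_gt0.
have n_minus_2 : k.+3%:R - 2%:R = k.+1%:R :> R by rewrite -natrB.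
have n_minus_3 : k.+3%:R - 3%:R = k%:R :> R by rewrite -natrB // !subSS subn0.
rewrite /eps_o /eps_e n_minus_2 n_minus_3 !subSS subn0 degree_poly_CL /=.
rewrite !negbK; set q := CL_cofactor R k.
have q_at_n2 : q.[- k.+1%:R] = 1 := CL_cofactor_at_clique_size R k.
split=> [even_k | odd_k].
- have := CL_cofactor_even_lt0 R k_gt0 even_k; rewrite -/q opprD.
  set a := - _ - _ => q_other_end.
  have le_a : a <= - k.+1%:R.
    by rewrite gerDl oppr_le0 divr_ge0 ?exprn_ge0 ?ler0n.
  have [||x /andP[ax xb] qx0] := @poly_ivt R q a (- k.+1%:R).
  + exact: le_a.
  + by rewrite q_at_n2 ltW ?ler01.
  exists x; split; last by rewrite rootM qx0 orbT.
  (* The values of q at the two ends are nonzero, so x is neither. *)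
  rewrite !lt_neqAle ax xb !andbT; apply/andP; split.
  + by apply: contraTneq qx0 => <-; rewrite /root lt_eqF.
  + by apply: contraTneq qx0 => ->; rewrite /root q_at_n2 oner_eq0.
(* The cofactor now changes sign from positive to nonpositive, so the
   intermediate value theorem is applied to - q. *)
- have := CL_cofactor_odd_le0 R odd_k; rewrite -/q opprB addrC.
  set b := - _ + _ => q_other_end.
  have le_b : - k.+1%:R <= b.
    by rewrite lerDl divr_ge0 ?exprn_ge0 ?ler0n.
  have [||x /andP[ax xb] qx0] := @poly_ivt R (- q) (- k.+1%:R) b.
  + exact: le_b.
  + by rewrite !hornerN q_at_n2 oppr_le0 ler01 oppr_ge0.
  rewrite rootN in qx0.
  exists x; split; last by rewrite rootM qx0 orbT.
  rewrite lt_neqAle ax xb !andbT.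
  by apply: contraTneq qx0 => <-; rewrite /root q_at_n2 oner_eq0.
Qed.
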